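(* If $f:[\omega_2]^2\rightarrow[\omega_2]^{\leq\omega}$ has the strong property $\Delta$, then $V^{\mathbb{P}_f}$ satisfies ''for all $n\in\mathbb{N}$, $K_f^n$ is hereditarily separable'', where $\mathbb{P}_f$ is the forcing notion and $K_f$ is the generic compact space associated with $f$ defined in the context.
   Context: Notation: $[X]^2$, $[X]^{\le\omega}$, $[X]^{<\omega}$ are the families of two-element, countable, finite subsets of $X$; $\wp(X)$ is the power set. Ordinals are identified with the sets of smaller ordinals. Strong property $\Delta$. A function $f:[\omega_2]^2\rightarrow[\omega_2]^{\leq\omega}$ has the strong property $\Delta$ if $f(\{\xi,\eta\})\subseteq\min\{\xi,\eta\}$ for all $\{\xi,\eta\}\in[\omega_2]^2$ and for any uncountable $\Delta$-system $\mathcal{A}$ of finite subsets of $\omega_2$ there are distinct $a,b\in\mathcal{A}$ and an order-preserving bijection $e:a\rightarrow b$ which is the identity on $a\cap b$ and such that $\xi\leq e(\xi)$ for all $\xi\in a$, and for any $\tau\in a\cap b$, any $\xi\in a\setminus b$ and any $\eta\in b\setminus a$: 1) $a\cap\min\{\xi,\eta\}\subseteq f(\{\xi,\eta\})$; 2) $\tau<\xi\Rightarrow f(\{\tau,\eta\})\subseteq f(\{\xi,\eta\})$; 3) $\tau<\eta\Rightarrow f(\{\tau,\xi\})\subseteq f(\{\xi,\eta\})$. The forcing $\mathbb{P}_f$. Conditions are triples $p=(D_p,h_p,i_p)$ where: 1. $D_p\in[\omega_2]^{<\omega}$; 2. $h_p:D_p\rightarrow\wp(D_p)$ and $\max h_p(\xi)=\xi$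 for all $\xi\in D_p$; 3. $i_p:[D_p]^2\rightarrow[D_p]^{<\omega}$ and for all $\xi<\eta$ in $D_p$: (a) if $\xi\in h_p(\eta)$, then $h_p(\xi)\setminus h_p(\eta)\subseteq\bigcup_{\gamma\in i_p(\{\xi,\eta\})}h_p(\gamma)$; (b) if $\xi\notin h_p(\eta)$, then $h_p(\xi)\cap h_p(\eta)\subseteq\bigcup_{\gamma\in i_p(\{\xi,\eta\})}h_p(\gamma)$; (c) $i_p(\{\xi,\eta\})\subseteq f(\{\xi,\eta\})$. The order: $p\leq q$ if $D_p\supseteq D_q$, $h_p(\xi)\cap D_q=h_q(\xi)$ for all $\xi\in D_q$, and $i_p|_{[D_q]^2}=i_q$. The space $K_f$. Let $V$ be the ground model and $G$ a $\mathbb{P}_f$-generic filter over $V$. In $V^{\mathbb{P}_f}$ put $h(\xi)=\bigcup\{h_p(\xi):p\in G,\ \xi\in D_p\}$ for $\xi<\omega_2$. Let $L_f$ be $\omega_2$ with the topology having $\{h(\xi):\xi<\omega_2\}\cup\{\omega_2\setminus h(\xi):\xi<\omega_2\}$ as a subbasis (it is a locally compact scattered zero-dimensional space), and let $K_f$ be the one-point compactification of $L_f$. *)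

(* Defs.v *)
From mathcomp Require Import all_boot all_order finmap.
From mathcomp Require Import boolp classical_sets functions cardinality.

Set Implicit Arguments.
Unset Strict Implicit.
Unset Printing Implicit Defensive.

Import Order.TTheory.
Local Open Scope classical_set_scope.

(******************************************************************************)
(* The ordinal omega_2, presented as a totally ordered type W.                *)
(* [below a] is the ordinal a, seen as the set of smaller ordinals.           *)
(******************************************************************************)
Section Omega2.
Context {d : Order.disp_t} (W : orderType d).

Definition below (a : W) : set W := [set x | (x < a)%O].

Definition is_omega1 (a : W) : Prop :=
  ~ countable (below a) /\ forall x, (x < a)%O -> countable (below x).

Definition is_omega2 : Prop :=
  well_founded (fun x y : W => (x < y)%O) /\
  exists w1 : W,
    [/\ is_omega1 w1,
        forall x : W, (below x #<= below w1)%card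
      & ~ ([set: W] #<= below w1)%card].

End Omega2.

(******************************************************************************)
(* A function f on [W]^2 is a function on finite sets of which only the       *)
(* values at the two-element sets [fset x; y] are ever used.                  *)
(******************************************************************************)
Section StrongDelta.
Context {d : Order.disp_t} {W : orderType d}.
Implicit Types (f : {fset W} -> set W) (a b : {fset W}).

Definition countable_valued f : Prop :=
  forall x y : W, x != y -> countable (f [fset x; y]%fset).

Definition Delta_system (A : set {fset W}) : Prop :=
  exists r : {fset W},
    forall a b, A a -> A b -> a != b -> (a `&` b)%fset = r.

Definition strong_Delta_pair f a b (e : W -> W) : Prop :=
  [/\ {in a &, {homo e : x y / (x < y)%O}},
      [fset e x | x in a]%fset = b,
      forall t, t \in (a `&` b)%fset -> e t = t,
      forall x, x \in a -> (x <= e x)%O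
    & forall t x y,
        t \in (a `&` b)%fset -> x \in (a `\` b)%fset -> y \in (b `\` a)%fset ->
        [/\ [set` a] `&` below (Order.min x y) `<=` f [fset x; y]%fset,
            (t < x)%O -> f [fset t; y]%fset `<=` f [fset x; y]%fset
          & (t < y)%O -> f [fset t; x]%fset `<=` f [fset x; y]%fset]].

Definition strong_property_Delta f : Prop :=
  (forall x y, x != y -> f [fset x; y]%fset `<=` below (Order.min x y)) /\
  forall A : set {fset W}, ~ countable A -> Delta_system A ->
    exists a b, [/\ A a, A b, a != b & exists e, strong_Delta_pair f a b e].

End StrongDelta.

(******************************************************************************)
(* Conditions. The functions h_p on D_p and i_p on [D_p]^2 are represented by *)
(* total functions whose other values are irrelevant: two representations of  *)
(* the same triple are below each other, so they force the same statements.   *)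
(******************************************************************************)
Section Conditions.
Context {d : Order.disp_t} {W : orderType d} (f : {fset W} -> set W).

Record cond := Cond {
  cD : {fset W};
  ch : W -> {fset W};
  ci : {fset W} -> {fset W};
  ch_sub : forall x, x \in cD -> (ch x `<=` cD)%fset;
  ch_max : forall x, x \in cD ->
    x \in ch x /\ forall z, z \in ch x -> (z <= x)%O;
  ci_sub : forall x y, x \in cD -> y \in cD -> (x < y)%O ->
    (ci [fset x; y] `<=` cD)%fset;
  ci_in : forall x y, x \in cD -> y \in cD -> (x < y)%O -> x \in ch y ->
    (ch x `\` ch y `<=` \bigcup_(g <- ci [fset x; y]) ch g)%fset;
  ci_notin : forall x y, x \in cD -> y \in cD -> (x < y)%O -> x \notin ch y ->
    (ch x `&` ch y `<=` \bigcup_(g <- ci [fset x; y]) ch g)%fset;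
  ci_f : forall x y, x \in cD -> y \in cD -> (x < y)%O ->
    [set` ci [fset x; y]%fset] `<=` f [fset x; y]%fset
}.

Definition cond_le (p q : cond) : Prop :=
  [/\ (cD q `<=` cD p)%fset,
      forall x, x \in cD q -> (ch p x `&` cD q)%fset = ch q x
    & forall x y, x \in cD q -> y \in cD q -> x != y ->
        ci p [fset x; y]%fset = ci q [fset x; y]%fset].

End Conditions.

(******************************************************************************)
(* The forcing relation of a forcing notion (P, le) over the ground model V   *)
(* consisting of the types of Rocq. A statement phi of the forcing language   *)
(* is identified with { p | p forces phi }; connectives and quantifiers       *)
(* follow the usual recursive definition of p ||- phi, with negation,         *)
(* conjunction and universal quantification as primitives.                    *)
(*                                                                            *)
(* Names are used in typed form. For a ground-model type X:                   *)
(* - an element of X^check is named by an x : X (below any condition, every   *)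
(*   name for an element of X^check is decided to be one of these); this also *)
(*   covers n-tuples of elements of X, as finite sequences of elements of     *)
(*   the ground model belong to the ground model;                             *)
(* - a subset of X^check is named by a set A of pairs (x, r), r in P;         *)
(* - a set of subsets of X^check is named by a set of pairs (A, r), A being   *)
(*   itself a name for a subset.                                              *)
(* A finite sequence of subsets is named by a finite sequence of names.       *)
(******************************************************************************)
Declare Scope forcing_scope.

Section Forcing.
Context {P : Type} (le : P -> P -> Prop).

Definition fprop : Type := P -> Prop.

Definition fground (Q : Prop) : fprop := fun _ => Q.
Definition fnot (F : fprop) : fprop := fun p => forall q, le q p -> ~ F q.
Definition fand (F G : fprop) : fprop := fun p => F p /\ G p.
Definition fall (A : Type) (F : A -> fprop) : fprop := fun p => forall a, F a p.
Definition fimp (F G : fprop) : fprop := fnot (fand F (fnot G)).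
Definition fiff (F G : fprop) : fprop := fand (fimp F G) (fimp G F).
Definition fex (A : Type) (F : A -> fprop) : fprop :=
  fnot (fall (fun a => fnot (F a))).

Local Notation "F &&& G" := (fand F G)
  (at level 80, right associativity) : forcing_scope.
Local Notation "F ==>> G" := (fimp F G)
  (at level 90, right associativity) : forcing_scope.
Local Notation "'ALL' x .. y , F" := (fall (fun x => .. (fall (fun y => F)) ..))
  (at level 200, x binder, y binder, right associativity) : forcing_scope.
Local Notation "'EX' x .. y , F" := (fex (fun x => .. (fex (fun y => F)) ..))
  (at level 200, x binder, y binder, right associativity) : forcing_scope.
Local Open Scope forcing_scope.

Definition name (X : Type) : Type := X -> P -> Prop.

(* p forces a \in A iff the set of q such that q <= r and q forces a = b for  *)
(* some (b, r) in A is dense below p; eq is forced equality.                  *)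
Definition fmem_by (X : Type) (eq : X -> X -> fprop) (a : X) (A : name X) :
    fprop :=
  fun p => forall q, le q p ->
    exists2 q', le q' q & exists b r, [/\ A b r, le q' r & eq a b q'].

Definition feq (X : Type) (x y : X) : fprop := fground (x = y).
Definition fmem (X : Type) (x : X) (A : name X) : fprop :=
  fmem_by (@feq X) x A.

Definition feq_set (X : Type) (A B : name X) : fprop :=
  ALL x, fiff (fmem x A) (fmem x B).
Definition fmem_set (X : Type) (A : name X) (S : name (name X)) : fprop :=
  fmem_by (@feq_set X) A S.

Definition fcompl (X : Type) (A : name X) : name X := fun x => fnot (fmem x A).

(* A topology on X^check in the extension is given by the forcing statement   *)
(* "U is open" about names U for subsets of X^check.                          *)
Definition topology (X : Type) : Type := name X -> fprop.

Definition generated_topology (X : Type) (S : name (name X)) : topology X :=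
  fun U => ALL x, fmem x U ==>>
    EX (n : nat) (V : 'I_n -> name X),
      (ALL i, fmem_set (V i) S) &&& (ALL i, fmem x (V i)) &&&
      (ALL y, (ALL i, fmem y (V i)) ==>> fmem y U).

Definition fcompact (X : Type) (opn : topology X) (C : name X) : fprop :=
  ALL S : name (name X),
    (ALL U, fmem_set U S ==>> opn U) ==>>
    (ALL x, fmem x C ==>> EX U, fmem_set U S &&& fmem x U) ==>>
    EX (n : nat) (V : 'I_n -> name X),
      (ALL i, fmem_set (V i) S) &&&
      (ALL x, fmem x C ==>> EX i, fmem x (V i)).

(* The point at infinity is None; the complement in X of an open              *)
(* neighbourhood of None is required to be closed and compact.                *)
Definition one_point_compactification (X : Type) (opn : topology X) :
    topology (option X) :=
  fun U => let UX : name X := fun x => U (Some x) in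
    opn UX &&& (fmem None U ==>> fcompact opn (fcompl UX)).

Definition power_topology (X : Type) (opn : topology X) (n : nat) :
    topology ('I_n -> X) :=
  fun O => ALL x, fmem x O ==>>
    EX U : 'I_n -> name X,
      (ALL i, opn (U i) &&& fmem (x i) (U i)) &&&
      (ALL y, (ALL i, fmem (y i) (U i)) ==>> fmem y O).

(* g is an injective partial function to omega, defined at least on D. *)
Definition fcountable (X : Type) (D : name X) : fprop :=
  EX g : name (X * nat),
    (ALL x, fmem x D ==>> EX k, fmem (x, k) g) &&&
    (ALL x k l, fmem (x, k) g ==>> fmem (x, l) g ==>> feq k l) &&&
    (ALL x y k, fmem (x, k) g ==>> fmem (y, k) g ==>> feq x y).

Definition fdense_in (X : Type) (opn : topology X) (D Y : name X) : fprop :=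
  (ALL x, fmem x D ==>> fmem x Y) &&&
  (ALL U, opn U ==>> (EX x, fmem x U &&& fmem x Y) ==>>
     EX x, fmem x U &&& fmem x D).

Definition hereditarily_separable (X : Type) (opn : topology X) : fprop :=
  ALL Y : name X, EX D : name X, fcountable D &&& fdense_in opn D Y.

Definition extension_satisfies (F : fprop) : Prop := forall p, F p.

End Forcing.

Section GenericSpace.
Context {d : Order.disp_t} {W : orderType d} (f : {fset W} -> set W).

Local Notation name := (@name (cond f)).

Definition hdot (x : W) : name W := fun y p => x \in cD p /\ y \in ch p x.

Definition subbasis : name (name W) :=
  fun A _ => exists x, A = hdot x \/ A = fcompl (@cond_le d W f) (hdot x).

Definition L_space : topology W :=
  generated_topology (@cond_le d W f) subbasis.

Definition K_space : topology (option W) :=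
  one_point_compactification (@cond_le d W f) L_space.

End GenericSpace.

Arguments cond_le {d W f}.
Arguments K_space {d W} f.

(* Main.v *)
Require Import Defs.
From mathcomp Require Import all_boot all_order finmap.
From mathcomp Require Import boolp classical_sets functions cardinality.

Set Implicit Arguments.
Unset Strict Implicit.
Unset Printing Implicit Defensive.

Import Order.TTheory.

(** Were the power of the space not hereditarily separable in the extension,
    some subspace Y would contain a left-separated sequence of length omega_1.
    The ground model sees this through triples (p, x, F) in which p forces x
    to be in Y and F describes a basic box around x.  For a countable set C of
    such triples, the points of C whose condition lies in the generic filter
    form a countable subset of Y in the extension.  Either some C makes this
    subset dense in Y, or for every countable C there is a triple whose box
    avoids, below its condition, all points of C; recursion along omega_1 then
    gives triples t_alpha, each avoiding the previous ones
    ([exists_maximal_family]).  All combinatorics thus takes place in the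
    ground model.

    The boxes come from a description of neighbourhoods.  If u is in h(w),
    then clause (a) says that h(u) minus h(w) is covered by finitely many h(g)
    with g < u, so the sets h(u) minus a finite union of h(g) that misses u
    form a local base at u ([box_inL_open]).  At infinity, compactness of the
    complement yields a finite set F with the complement of the union of h(g),
    g in F, inside the given neighbourhood ([box_in_open_infty]).

    The sequence t_alpha is impossible.  Thinning out by countable codes and by
    the Delta-system lemma, the conditions become isomorphic over a fixed root,
    and the strong property Delta provides alpha < beta and an isomorphism e
    of the domains that moves no point down.  The two conditions then have a common
    extension s such that, for u in the first domain and v in the second, u is
    in h_s(v) iff e(u) is in the set h(v) of the second condition
    ([amalgamation], [compatible_pair]).  As e takes x_alpha to x_beta, and
    x_beta is in the box of t_beta, s puts x_alpha into that box as well. *)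

(** * Conditions *)

Section ConditionTheory.
Context {d : Order.disp_t} {W : orderType d} {f : {fset W} -> set W}.
Implicit Types (p q r s : cond f) (x y z : W).
Local Open Scope classical_set_scope.

Lemma cond_le_refl p : cond_le p p.
Proof.
split=> [|x xp|//]; first exact: fsubset_refl.
by apply/fsetIidPl; exact: ch_sub.
Qed.

Lemma cond_le_trans q p r : cond_le p q -> cond_le q r -> cond_le p r.
Proof.
move=> [Dpq hpq ipq] [Dqr hqr iqr]; split.
- exact: fsubset_trans Dqr Dpq.
- move=> x xr; have xq := fsubsetP Dqr x xr.
  rewrite -(hqr x xr) -(hpq x xq) -fsetIA.
  by congr fsetI; apply/esym/fsetIidPr.
- move=> x y xr yr xy.
  by rewrite ipq ?iqr // (fsubsetP Dqr).
Qed.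

Lemma cond_le_cD p q x : cond_le p q -> x \in cD q -> x \in cD p.
Proof. by case=> /fsubsetP D _ _; exact: D. Qed.

Lemma cond_le_ch p q x y : cond_le p q -> x \in cD q -> y \in cD q ->
  (y \in ch p x) = (y \in ch q x).
Proof. by case=> _ h _ xq yq; rewrite -(h x xq) in_fsetI yq andbT. Qed.

Lemma mem_ch_self p x : x \in cD p -> x \in ch p x.
Proof. by move=> xp; case: (ch_max xp). Qed.

Lemma ch_le p x z : x \in cD p -> z \in ch p x -> (z <= x)%O.
Proof. by move=> xp; case: (ch_max xp) => _; apply. Qed.

Lemma mem_ci_in p x y z : x \in cD p -> y \in cD p -> (x < y)%O ->
  x \in ch p y -> z \in ch p x -> z \notin ch p y ->
  exists2 g, g \in ci p [fset x; y]%fset & z \in ch p g.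
Proof.
move=> xp yp xy xhy zx zy.
have /fsubsetP/(_ z) := ci_in xp yp xy xhy.
by rewrite in_fsetD zx zy => /(_ isT) /bigfcupP[g]; rewrite andbT; exists g.
Qed.

Lemma mem_ci_notin p x y z : x \in cD p -> y \in cD p -> (x < y)%O ->
  x \notin ch p y -> z \in ch p x -> z \in ch p y ->
  exists2 g, g \in ci p [fset x; y]%fset & z \in ch p g.
Proof.
move=> xp yp xy xhy zx zy.
have /fsubsetP/(_ z) := ci_notin xp yp xy xhy.
by rewrite in_fsetI zx zy => /(_ isT) /bigfcupP[g]; rewrite andbT; exists g.
Qed.

Lemma mem_ci_cD p x y z : x \in cD p -> y \in cD p -> (x < y)%O ->
  z \in ci p [fset x; y]%fset -> z \in cD p.
Proof. by move=> xp yp xy; exact: fsubsetP (ci_sub xp yp xy) z. Qed.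

Lemma mem_ci_f p x y z : x \in cD p -> y \in cD p -> (x < y)%O ->
  z \in ci p [fset x; y]%fset -> f [fset x; y]%fset z.
Proof. by move=> xp yp xy; exact: (ci_f xp yp xy). Qed.

(** A new point w is added as an isolated one: h(w) = {w}, and w belongs to no
    other h(x), so that every clause involving w asks to cover nothing. *)
Section AddPoint.
Variables (p : cond f) (w : W).
Hypothesis wp : w \notin cD p.

Let D := (w |` cD p)%fset.
Let h x := if x == w then [fset w]%fset else ch p x.
Let i (A : {fset W}) := if w \in A then fset0 else ci p A.

Let hP x z : x \in D -> z \in h x ->
  (x = w /\ z = w) \/ [/\ x \in cD p, x != w, z != w & z \in ch p x].
Proof.
rewrite /D /h in_fset1U; case: eqP => [-> _|/eqP xw /= xp zx].
  by rewrite in_fset1 => /eqP ->; left.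
right; split=> //; apply: contraNneq wp => <-.
exact: fsubsetP (ch_sub xp) z zx.
Qed.

Let old x : x \in D -> x != w -> x \in cD p /\ h x = ch p x.
Proof. by rewrite /D /h in_fset1U; case: eqP. Qed.

Let iE x y : x != w -> y != w -> i [fset x; y]%fset = ci p [fset x; y]%fset.
Proof.
move=> xw yw; rewrite /i in_fset2 eq_sym (negbTE xw) eq_sym.
by rewrite (negbTE yw).
Qed.

Let memh x : x \in cD p -> h x = ch p x.
Proof. by move=> xp; rewrite /h; case: eqP => // E; move: wp; rewrite -E xp. Qed.

Lemma cond_add_point : exists2 s : cond f, cond_le s p & w \in cD s.
Proof.
have pw x : x \in cD p -> x != w by move=> xp; apply: contraNneq wp => <-.
have hsub x : x \in D -> (h x `<=` D)%fset.
  move=> xD; apply/fsubsetP=> z /(hP xD)[[_ ->]|[xp xw zw zx]].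
    by rewrite in_fset1U eqxx.
  by rewrite in_fset1U (fsubsetP (ch_sub xp) z zx) orbT.
have hmax x : x \in D -> x \in h x /\ forall z, z \in h x -> (z <= x)%O.
  move=> xD; split.
    have [->|/(old xD)[xp ->]] := eqVneq x w; last exact: mem_ch_self.
    by rewrite /h eqxx in_fset1.
  by move=> z /(hP xD)[[-> ->//]|[xp _ _ zx]]; exact: ch_le zx.
have isub x y : x \in D -> y \in D -> (x < y)%O ->
    (i [fset x; y] `<=` D)%fset.
  move=> xD yD xy; rewrite /i; case: ifPn => [_|]; first exact: fsub0set.
  rewrite in_fset2 negb_or ![w == _]eq_sym => /andP[xw yw].
  have [[xp _] [yp _]] := (old xD xw, old yD yw).
  apply: fsubset_trans (ci_sub xp yp xy) _; exact: fsubsetU1.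
have icov x y z : x \in cD p -> y \in cD p -> (x < y)%O ->
    (exists2 g, g \in ci p [fset x; y]%fset & z \in ch p g) ->
    z \in (\bigcup_(g <- i [fset x; y]) h g)%fset.
  move=> xp yp xy [g gi zg]; apply/bigfcupP; exists g.
    by rewrite iE ?pw // gi.
  by rewrite memh // (mem_ci_cD xp yp xy).
have iin x y : x \in D -> y \in D -> (x < y)%O -> x \in h y ->
    (h x `\` h y `<=` \bigcup_(g <- i [fset x; y]) h g)%fset.
  move=> xD yD xy /(hP yD)[[Ey Ex]|[yp yw xw xhy]].
    by rewrite Ex Ey ltxx in xy.
  have [xp hx] := old xD xw; have [_ hy] := old yD yw.
  apply/fsubsetP=> z; rewrite hx hy in_fsetD => /andP[zy zx].
  by apply: icov => //; exact: mem_ci_in.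
have inotin x y : x \in D -> y \in D -> (x < y)%O -> x \notin h y ->
    (h x `&` h y `<=` \bigcup_(g <- i [fset x; y]) h g)%fset.
  move=> xD yD xy xhy; apply/fsubsetP=> z; rewrite in_fsetI => /andP[zx zy].
  case: (hP xD zx) => [[Ex Ez]|[xp xw zw zhx]].
    by rewrite Ex -Ez zy in xhy.
  case: (hP yD zy) => [[Ey Ez]|[yp yw _ zhy]]; first by rewrite Ez eqxx in zw.
  apply: icov => //; apply: mem_ci_notin zhx zhy => //.
  by rewrite -(memh yp).
have iff x y : x \in D -> y \in D -> (x < y)%O ->
    [set` i [fset x; y]%fset] `<=` f [fset x; y]%fset.
  move=> xD yD xy z /=; rewrite /i; case: ifPn => [//|].
  rewrite in_fset2 negb_or ![w == _]eq_sym => /andP[xw yw].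
  have [[xp _] [yp _]] := (old xD xw, old yD yw).
  exact: mem_ci_f.
exists (@Cond d W f D h i hsub hmax isub iin inotin iff); last first.
  by rewrite /= in_fset1U eqxx.
split=> /= [|x xp|x y xp yp xy].
- exact: fsubsetU1.
- by rewrite memh //; apply/fsetIidPl; exact: ch_sub.
- by rewrite iE ?pw.
Qed.

End AddPoint.

Lemma cond_dense_cD p w : exists2 s : cond f, cond_le s p & w \in cD s.
Proof.
have [wp|wp] := boolP (w \in cD p); last exact: cond_add_point.
by exists p => //; exact: cond_le_refl.
Qed.

Lemma cond_dense_fsub p (A : {fset W}) :
  exists2 s : cond f, cond_le s p & (A `<=` cD s)%fset.
Proof.
suff H (l : seq W) : exists2 s, cond_le s p & {subset l <= cD s}.
  by have [s sp As] := H (enum_fset A); exists s => //; apply/fsubsetP.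
elim: l => [|w l [s sp ls]]; first by exists p => //; exact: cond_le_refl.
have [t ts wt] := cond_dense_cD s w.
exists t; first exact: cond_le_trans ts sp.
by move=> x; rewrite inE => /predU1P[->//|/ls]; exact: cond_le_cD.
Qed.

End ConditionTheory.

(** * Amalgamation of two isomorphic conditions *)

(** The conditions p and q live on a and b, and e carries h_p to h_q; it moves no
    point down and fixes the root, the intersection of a and b.  In the
    amalgam every new point behaves towards an old condition like a point of
    that condition.  A point x of a is, for q, a copy of e(x).  For p, a point
    x of b \ a cannot be a copy of its preimage under e, since max h(y) = y
    forbids x in h(y) for y < x; it is instead a copy of the least t in the
    root with x in h(t), which is at least x, and it is in no h(y) with y in a
    if there is no such t.  For pairs inside a or inside b the clauses are thus
    inherited.  On a new pair, i takes all of f within the domain, and the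
    strong property Delta says that this is enough. *)

Section Amalgamation.
Context {d : Order.disp_t} {W : orderType d} {f : {fset W} -> set W}.
Variables (p q : cond f) (e : W -> W).
Local Open Scope classical_set_scope.

Let a := cD p.
Let b := cD q.

Hypothesis fmin : forall x y, x != y ->
  f [fset x; y]%fset `<=` below (Order.min x y).
Hypothesis e_id : forall x, x \in a -> x \in b -> e x = x.
Hypothesis e_ge : forall x, x \in a -> (x <= e x)%O.
Hypothesis e_ch : forall x y, x \in a -> y \in a ->
  (x \in ch p y) = (e x \in ch q (e y)).
Hypothesis ci_root : forall x y, x \in a -> x \in b -> y \in a -> y \in b ->
  x != y -> ci p [fset x; y]%fset = ci q [fset x; y]%fset.
Hypothesis f_below : forall x y, x \in a -> x \notin b -> y \in b ->
  y \notin a -> [set` a] `&` below (Order.min x y) `<=` f [fset x; y]%fset.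
Hypothesis f_root : forall t x y, t \in a -> t \in b -> x \in a ->
  x \notin b -> y \in b -> y \notin a -> (t < x)%O ->
  f [fset t; y]%fset `<=` f [fset x; y]%fset.

Let c := (a `|` b)%fset.

Let to_b x := if x \in a then e x else x.

Let is_low x t := [&& t \in a, t \in b, x \in ch q t &
  all (fun t' => (t' \in b) && (x \in ch q t') ==> (t <= t')%O) a].

Let h y : {fset W} := if y \in b then [fset x in c | to_b x \in ch q y]%fset
  else [fset x in c | if x \in a then x \in ch p y
                      else has (fun t => is_low x t && (t \in ch p y)) a]%fset.

Let i (A : {fset W}) : {fset W} :=
  if (A `<=` a)%fset then ci p A else if (A `<=` b)%fset then ci q A
  else [fset z in c | `[< f A z >]]%fset.

Let mem_sep (A : {fset W}) (P : pred W) x :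
  (x \in [fset z in A | P z]%fset) = (x \in A) && P x.
Proof. by rewrite !inE. Qed.

Let lowP x t : is_low x t ->
  [/\ t \in a, t \in b, x \in ch q t &
      forall t', t' \in a -> t' \in b -> x \in ch q t' -> (t <= t')%O].
Proof.
case/and4P=> ta tb xt /allP m; split=> // t' t'a t'b xt'.
by have := m t' t'a; rewrite t'b xt'.
Qed.

Let low_uniq x t t' : is_low x t -> is_low x t' -> t = t'.
Proof.
move=> /lowP[ta tb xt m] /lowP[t'a t'b xt' m'].
by apply/eqP; rewrite eq_le m ?m'.
Qed.

Let low_ex x t0 : t0 \in a -> t0 \in b -> x \in ch q t0 ->
  exists2 t, is_low x t & (t <= t0)%O.
Proof.
move=> t0a t0b xt0.
have minP (l : seq W) : t0 \in l -> exists2 m, m \in l & {in l, forall y, m <= y}%O.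
  elim: l {xt0} t0 {t0a t0b} => [//|z l IH] t0 _.
  case: l IH => [|z' l] IH.
    by exists z; rewrite ?inE // => y; rewrite inE => /eqP->.
  have [m ml mm] := IH z' (mem_head _ _).
  have [zm|mz] := leP z m.
    exists z; first exact: mem_head.
    by move=> y; rewrite inE => /predU1P[->//|/mm]; exact: le_trans.
  exists m; first by rewrite inE ml orbT.
  by move=> y; rewrite inE => /predU1P[->|/mm//]; exact: ltW.
have [|m] := minP [seq t <- a | (t \in b) && (x \in ch q t)].
  by rewrite mem_filter t0b xt0.
rewrite mem_filter -andbA => /and3P[mb xm ma] mm; exists m.
  apply/and4P; split=> //; apply/allP=> t' t'a; apply/implyP=> t'P.
  by apply: mm; rewrite mem_filter t'P.
by apply: mm; rewrite mem_filter t0b xt0.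
Qed.

(** On the root, x and its low point t lie in the same sets h(y): otherwise a
    clause for the pair {t, y} would put x into some h(g) with g in i{t, y}.
    As p and q agree on this value of i, g would be in the root, and below t. *)
Let low_root x t y : is_low x t -> y \in a -> y \in b ->
  (x \in ch q y) = (t \in ch q y).
Proof.
move=> /lowP[ta tb xt m] ya yb.
have root_i u v : u \in a -> u \in b -> v \in a -> v \in b -> (u < v)%O ->
    forall g, g \in ci q [fset u; v]%fset -> [/\ g \in a, g \in b & (g < u)%O].
  move=> ua ub va vb uv g gi; split; last 2 first.
  - exact: mem_ci_cD gi.
  - have := fmin _ (mem_ci_f ub vb uv gi).
    by rewrite lt_eqF // min_l ?ltW //; apply.
  - have := gi; rewrite -ci_root ?lt_eqF //; exact: mem_ci_cD.
have [yt|ty|->] := ltgtP y t; last first.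
- by rewrite xt mem_ch_self.
- have [ty'|ty'] := boolP (t \in ch q y).
  + apply: contraT => xy'.
    have [g gi xg] := mem_ci_in tb yb ty ty' xt xy'.
    have [ga gb gt] := root_i _ _ ta tb ya yb ty g gi.
    by have := m g ga gb xg; rewrite leNgt gt.
  + apply/negP => xy; have [g gi xg] := mem_ci_notin tb yb ty ty' xt xy.
    have [ga gb gt] := root_i _ _ ta tb ya yb ty g gi.
    by have := m g ga gb xg; rewrite leNgt gt.
- apply/idP/idP => [/(m y ya yb)|/(ch_le yb)]; by rewrite leNgt yt.
Qed.

Let root_ch x y : x \in a -> x \in b -> y \in a -> y \in b ->
  (x \in ch p y) = (x \in ch q y).
Proof. by move=> xa xb ya yb; rewrite e_ch // !e_id. Qed.

Let hb x y : y \in b -> x \in c -> (x \in h y) = (to_b x \in ch q y).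
Proof. by move=> yb xc; rewrite /h yb mem_sep xc. Qed.

Let ha_a x y : y \in a -> x \in a -> (x \in h y) = (x \in ch p y).
Proof.
move=> ya xa; have xc : x \in c by rewrite in_fsetU xa.
have [yb|yb] := boolP (y \in b).
  by rewrite hb // /to_b xa e_ch // (e_id ya yb).
by rewrite /h (negbTE yb) mem_sep xc xa.
Qed.

Let ha_b x y : y \in a -> x \in b -> x \notin a ->
  reflect (exists2 t, is_low x t & t \in ch p y) (x \in h y).
Proof.
move=> ya xb xa; have xc : x \in c by rewrite in_fsetU xb orbT.
have [yb|yb] := boolP (y \in b).
  rewrite hb // /to_b (negbTE xa); apply: (iffP idP) => [xy|[t tl ty]].
    have [t tl _] := low_ex ya yb xy; exists t => //.
    by have [ta tb _ _] := lowP tl; rewrite root_ch // -(low_root tl ya yb).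
  by have [ta tb _ _] := lowP tl; rewrite (low_root tl ya yb) -root_ch.
rewrite /h (negbTE yb) mem_sep xc (negbTE xa) /=.
apply: (iffP hasP) => [[t _ /andP[]]|[t tl ty]]; first by exists t.
by exists t; rewrite ?tl //; have [] := lowP tl.
Qed.

Let h_sub y : y \in c -> (h y `<=` c)%fset.
Proof.
by move=> _; apply/fsubsetP=> x; rewrite /h; case: ifP => _; rewrite mem_sep => /andP[].
Qed.

Let inc x : x \in c -> {x \in a} + {x \in b /\ x \notin a}.
Proof.
move=> xc; case: (boolP (x \in a)) => xa; [by left|right].
by move: xc; rewrite in_fsetU (negbTE xa).
Qed.

Let h_self y : y \in c -> y \in h y.
Proof.
move=> yc; have [ya|[yb ya]] := inc yc; first by rewrite ha_a // mem_ch_self.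
by rewrite hb // /to_b (negbTE ya) mem_ch_self.
Qed.

Let h_le x y : y \in c -> x \in h y -> (x <= y)%O.
Proof.
move=> yc xy; have xc := fsubsetP (h_sub yc) x xy.
have [xa|[xb xa]] := inc xc.
  have [ya|[yb ya]] := inc yc.
    by move: xy; rewrite ha_a //; exact: ch_le.
  move: xy; rewrite hb // /to_b xa => /(ch_le yb).
  exact: le_trans (e_ge xa).
have [ya|[yb ya]] := inc yc.
  case/(ha_b ya xb xa): xy => t /lowP[ta tb xt _] /(ch_le ya).
  exact: le_trans (ch_le tb xt).
by move: xy; rewrite hb // /to_b (negbTE xa) => /(ch_le yb).
Qed.

Let a_c x : x \in a -> x \in c. Proof. by rewrite in_fsetU => ->. Qed.
Let b_c x : x \in b -> x \in c. Proof. by rewrite in_fsetU orbC => ->. Qed.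

Let sub2 (x y : W) (A : {fset W}) :
  ([fset x; y] `<=` A)%fset = (x \in A) && (y \in A).
Proof. by rewrite fsubUset !fsub1set. Qed.

Let i_a x y : x \in a -> y \in a -> i [fset x; y]%fset = ci p [fset x; y]%fset.
Proof. by move=> xa ya; rewrite /i sub2 xa ya. Qed.

Let i_b x y : x \in b -> y \in b -> x != y ->
  i [fset x; y]%fset = ci q [fset x; y]%fset.
Proof.
move=> xb yb xy; rewrite /i !sub2 xb yb; case: ifP => // /andP[xa ya].
exact: ci_root.
Qed.

Let i_new x y g : x \in a -> x \notin b -> y \in b -> y \notin a ->
  (g \in i [fset x; y]%fset) = (g \in c) && `[< f [fset x; y]%fset g >].
Proof.
move=> xa xb yb ya.
by rewrite /i !sub2 (negbTE ya) (negbTE xb) andbF /= mem_sep.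
Qed.

(** Clauses (a) and (b) at once: each asks to cover the z in h(x) that h(y)
    treats differently from x. *)
Let covered x y := forall z, z \in h x ->
  (x \in h y) != (z \in h y) -> exists2 g, g \in i [fset x; y]%fset & z \in h g.

Let covered_b x y : x \in b -> y \in b -> (x < y)%O -> covered x y.
Proof.
move=> xb yb xy z zx; have zc := fsubsetP (h_sub (b_c xb)) z zx.
have xx : x \in h y = (x \in ch q y).
  rewrite hb ?b_c // /to_b; case: ifP => // xa; by rewrite e_id.
move: zx; rewrite xx !hb // => zx ne.
have [g gi zg] : exists2 g, g \in ci q [fset x; y]%fset & to_b z \in ch q g.
  case: (boolP (x \in ch q y)) ne => xy'; rewrite ?eqb_id => ne.
    apply: mem_ci_in => //; by move: ne; case: (_ \in _).
  by apply: mem_ci_notin => //; move: ne; case: (_ \in _).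
by exists g; rewrite ?i_b ?lt_eqF // hb // (mem_ci_cD xb yb xy).
Qed.

Let covered_a x y : x \in a -> y \in a -> (x < y)%O -> covered x y.
Proof.
move=> xa ya xy z zx; have zc := fsubsetP (h_sub (a_c xa)) z zx.
have cov w : w \in ch p x -> (x \in ch p y) != (w \in ch p y) ->
    exists2 g, g \in ci p [fset x; y]%fset & w \in ch p g.
  case: (boolP (x \in ch p y)) => xy' wx ne.
    by apply: mem_ci_in => //; move: ne; case: (_ \in _).
  by apply: mem_ci_notin => //; move: ne; case: (_ \in _).
rewrite i_a // ha_a //; have [za|[zb za]] := inc zc.
  rewrite ha_a // => ne; rewrite ha_a // in zx.
  have [g gi zg] := cov z zx ne; exists g => //.
  by rewrite ha_a // (mem_ci_cD xa ya xy).
case/(ha_b xa zb za): zx => t tl tx.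
have -> : (z \in h y) = (t \in ch p y).
  apply/(ha_b ya zb za)/idP => [[t' t'l]|ty]; last by exists t.
  by rewrite (low_uniq tl t'l).
move=> ne; have [g gi tg] := cov t tx ne; exists g => //.
by apply/(ha_b _ zb za); [exact: mem_ci_cD gi|exists t].
Qed.

Let i_new_a x y g : x \in a -> x \notin b -> y \in b -> y \notin a ->
  g \in a -> (g < x)%O -> (g < y)%O -> g \in i [fset x; y]%fset.
Proof.
move=> xa xb yb ya ga gx gy; rewrite i_new // a_c //=; apply/asboolP.
by apply: f_below => //; split=> //; rewrite /below /= lt_min gx.
Qed.

Let i_new_root x y t g : x \in a -> x \notin b -> y \in b -> y \notin a ->
  t \in a -> t \in b -> (t < x)%O -> (y < t)%O ->
  g \in ci q [fset y; t]%fset -> g \in i [fset x; y]%fset.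
Proof.
move=> xa xb yb ya ta tb tx yt gi; rewrite i_new // b_c ?(mem_ci_cD yb tb yt) //=.
apply/asboolP; apply: (f_root ta tb) => //.
by rewrite fsetUC; apply: mem_ci_f gi.
Qed.

(** Every z in h(x) other than x is below x, hence below y.  It is in a, or
    its low point is and is below x too; f{x, y} contains all these by the
    first clause of the strong property Delta. *)
Let covered_ab x y : x \in a -> x \notin b -> y \in b -> y \notin a ->
  (x < y)%O -> covered x y.
Proof.
move=> xa xb yb ya xy z zx ne; have zc := fsubsetP (h_sub (a_c xa)) z zx.
have zNx : z != x by apply: contraNneq ne => ->.
have [za|[zb za]] := inc zc.
  have zlx : (z < x)%O by rewrite lt_neqAle zNx h_le // a_c.
  exists z; last by rewrite h_self.
  by apply: i_new_a => //; exact: lt_trans xy.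
case/(ha_b xa zb za): (zx) => t tl tx; have [ta tb zt _] := lowP tl.
have tlx : (t < x)%O.
  by rewrite lt_neqAle (ch_le xa tx) andbT; apply: contraNneq xb => <-.
exists t; first by apply: i_new_a => //; exact: lt_trans xy.
by rewrite hb // /to_b (negbTE za).
Qed.

(** For z in a, or with its low point below y, one argues as for y above x.
    Otherwise a point t of the root with y < t < x separates y from z, and
    i{y, t} is contained in f{y, t}, hence in f{x, y}. *)
Let covered_ba x y : x \in a -> x \notin b -> y \in b -> y \notin a ->
  (y < x)%O -> covered y x.
Proof.
move=> xa xb yb ya yx z zy ne; have zc := fsubsetP (h_sub (b_c yb)) z zy.
rewrite fsetUC; have [za|[zb za]] := inc zc.
  have zly : (z < y)%O.
    by rewrite lt_neqAle h_le ?b_c // andbT; apply: contraNneq ya => <-.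
  exists z; last by rewrite h_self.
  by apply: i_new_a => //; exact: lt_trans yx.
have low_lt w t : is_low w t -> t \in ch p x -> (t < x)%O.
  move=> /lowP[_ tb _ _] /(ch_le xa); rewrite le_eqVlt => /predU1P[tx|//].
  by rewrite tx (negbTE xb) in tb.
have zhy : z \in ch q y by move: zy; rewrite hb // /to_b (negbTE za).
have sep t : t \in a -> t \in b -> (t < x)%O -> (y < t)%O ->
    (y \in ch q t) != (z \in ch q t) ->
    exists2 g, g \in i [fset x; y]%fset & z \in h g.
  move=> ta tb tx yt ne'.
  have [g gi zg] : exists2 g, g \in ci q [fset y; t]%fset & z \in ch q g.
    case: (boolP (y \in ch q t)) ne' => yt' ne'.
      by apply: mem_ci_in => //; move: ne'; case: (_ \in _).
    by apply: mem_ci_notin => //; move: ne'; case: (_ \in _).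
  exists g; first exact: i_new_root gi.
  by rewrite hb ?(mem_ci_cD yb tb yt gi) // /to_b (negbTE za).
have low_gt t : is_low y t -> (y < t)%O.
  move=> /lowP[ta tb /(ch_le tb)]; rewrite le_eqVlt => /predU1P[yt|//].
  by rewrite yt ta in ya.
have small t : is_low z t -> (t < y)%O -> (t < x)%O ->
    exists2 g, g \in i [fset x; y]%fset & z \in h g.
  move=> /lowP[ta tb zt _] ty tx; exists t; first exact: i_new_a.
  by rewrite hb // /to_b (negbTE za).
have nEy t : t \in a -> (t < y)%O \/ (y < t)%O.
  by move=> ta; case: (ltgtP t y) => [||E]; [left|right|rewrite -E ta in ya].
have [/(ha_b xa yb ya)[t tl tx]|yNx] := boolP (y \in h x).
  have {ne} zNx : z \notin h x.
    move: ne; have -> : y \in h x by apply/(ha_b xa yb ya); exists t.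
    by case: (z \in h x).
  have [ta tb yt m] := lowP tl; have tlx := low_lt _ _ tl tx.
  have [zt|zt] := boolP (z \in ch q t); last first.
    by apply: (sep t) => //; rewrite ?low_gt // yt (negbTE zt).
  have [u ul ut] := low_ex ta tb zt; have [ua ub zu _] := lowP ul.
  have ult : (u < t)%O.
    rewrite lt_neqAle ut andbT; apply: contraNneq zNx => ut'.
    by apply/(ha_b xa zb za); exists u => //; rewrite ut'.
  have ulx := lt_trans ult tlx.
  have [uy|yu] := nEy u ua; first exact: small ul uy ulx.
  apply: (sep u) => //; rewrite zu; apply: contraTneq ult => yu'.
  by rewrite -leNgt m // yu'.
have zhx : z \in h x by move: ne; rewrite (negbTE yNx); case: (z \in h x).
case/(ha_b xa zb za): zhx => t tl tx.
have [ta tb zt m] := lowP tl; have tlx := low_lt _ _ tl tx.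
have [ty|yt] := nEy t ta; first exact: small tl ty tlx.
have [yt'|yt'] := boolP (y \in ch q t); last first.
  by apply: (sep t) => //; rewrite zt (negbTE yt').
have [u ul ut] := low_ex ta tb yt'; have [ua ub yu _] := lowP ul.
have ult : (u < t)%O.
  rewrite lt_neqAle ut andbT; apply: contraNneq yNx => ut'.
  by apply/(ha_b xa yb ya); exists u => //; rewrite ut'.
apply: (sep u) => //; [exact: lt_trans tlx|exact: low_gt|].
rewrite yu; apply: contraTneq ult => zu.
by rewrite -leNgt m // -zu.
Qed.

Let coveredP x y : x \in c -> y \in c -> (x < y)%O -> covered x y.
Proof.
move=> xc yc; have [xa|xa] := boolP (x \in a).
  have [ya|ya] := boolP (y \in a); first exact: covered_a.
  have yb : y \in b by move: yc; rewrite in_fsetU (negbTE ya).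
  have [xb|xb] := boolP (x \in b); first exact: covered_b.
  exact: covered_ab.
have xb : x \in b by move: xc; rewrite in_fsetU (negbTE xa).
have [yb|yb] := boolP (y \in b); first exact: covered_b.
have ya : y \in a by move: yc; rewrite in_fsetU (negbTE yb) orbF.
exact: covered_ba.
Qed.

Let i_in x y g : x \in c -> y \in c -> (x < y)%O ->
  g \in i [fset x; y]%fset -> g \in c /\ f [fset x; y]%fset g.
Proof.
move=> xc yc xy; rewrite /i !sub2; case: ifP => [/andP[xa ya] gi|_].
  by split; [apply/a_c/(mem_ci_cD xa ya xy gi)|exact: mem_ci_f gi].
case: ifP => [/andP[xb yb] gi|_].
  by split; [apply/b_c/(mem_ci_cD xb yb xy gi)|exact: mem_ci_f gi].
by rewrite mem_sep => /andP[gc /asboolP].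
Qed.

Lemma amalgamation : exists s : cond f,
  [/\ cond_le s p, cond_le s q &
      forall x y, x \in cD p -> y \in cD q ->
        (x \in ch s y) = (e x \in ch q y)].
Proof.
have hmax y : y \in c -> y \in h y /\ forall z, z \in h y -> (z <= y)%O.
  by move=> yc; split; [exact: h_self|move=> z; exact: h_le].
have isub x y : x \in c -> y \in c -> (x < y)%O -> (i [fset x; y] `<=` c)%fset.
  by move=> xc yc xy; apply/fsubsetP=> g /(i_in xc yc xy)[].
have iin x y : x \in c -> y \in c -> (x < y)%O -> x \in h y ->
    (h x `\` h y `<=` \bigcup_(g <- i [fset x; y]) h g)%fset.
  move=> xc yc xy xhy; apply/fsubsetP=> z; rewrite in_fsetD => /andP[zy zx].
  have [|g gi zg] := coveredP xc yc xy zx; first by rewrite xhy (negbTE zy).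
  by apply/bigfcupP; exists g; rewrite ?gi.
have inotin x y : x \in c -> y \in c -> (x < y)%O -> x \notin h y ->
    (h x `&` h y `<=` \bigcup_(g <- i [fset x; y]) h g)%fset.
  move=> xc yc xy xhy; apply/fsubsetP=> z; rewrite in_fsetI => /andP[zx zy].
  have [|g gi zg] := coveredP xc yc xy zx; first by rewrite zy (negbTE xhy).
  by apply/bigfcupP; exists g; rewrite ?gi.
have iff x y : x \in c -> y \in c -> (x < y)%O ->
    [set` i [fset x; y]%fset] `<=` f [fset x; y]%fset.
  by move=> xc yc xy g /(i_in xc yc xy)[].
exists (@Cond d W f c h i h_sub hmax isub iin inotin iff); split.
- split=> /= [|y ya|x y xa ya _].
  + exact: fsubsetUl.
  + apply/fsetP=> x; rewrite in_fsetI; have [xa|xa] := boolP (x \in a).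
      by rewrite ha_a // andbT.
    by rewrite andbF; apply/esym; apply: contraNF xa; apply/fsubsetP/ch_sub.
  + exact: i_a.
- split=> /= [|y yb|x y xb yb xy].
  + exact: fsubsetUr.
  + apply/fsetP=> x; rewrite in_fsetI; have [xb|xb] := boolP (x \in b).
      rewrite hb ?b_c // andbT /to_b; case: ifP => // xa; by rewrite e_id.
    by rewrite andbF; apply/esym; apply: contraNF xb; apply/fsubsetP/ch_sub.
  + exact: i_b.
- by move=> x y xa yb /=; rewrite hb ?a_c // /to_b xa.
Qed.

End Amalgamation.

(** * Uncountable families *)

Section Uncountable.
Local Open Scope classical_set_scope.

Lemma countable_sub (T : Type) (A B : set T) :
  A `<=` B -> countable B -> countable A.
Proof. by move=> AB; apply/sub_countable/subset_card_le. Qed.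

Lemma countable_im (T U : Type) (g : T -> U) (A : set T) :
  countable A -> countable (g @` A).
Proof. exact: sub_countable (card_image_le _ _). Qed.

Lemma countable_im_inj (T U : Type) (g : T -> U) (A : set T) :
  {in A &, injective g} -> countable (g @` A) -> countable A.
Proof.
move=> gi /countable_injP[k ki]; apply/countable_injP; exists (k \o g).
move=> x y xA yA /= kE; apply: gi => //; apply: ki => //.
  by rewrite inE; exists x => //; rewrite inE in xA.
by rewrite inE; exists y => //; rewrite inE in yA.
Qed.

Lemma uncountable_fibre (T : Type) (C : countType) (c : T -> C) (S : set T) :
  ~ countable S -> exists k, ~ countable (S `&` [set x | c x = k]).
Proof.
move=> uS; apply: contrapT => /forallNP H; apply: uS.
apply: countable_sub (_ : countable (\bigcup_k (S `&` [set x | c x = k]))).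
  by move=> x Sx; exists (c x).
by apply: bigcup_countable => // k _; apply: contrapT; exact: H.
Qed.

(** The dependence on the mere set of previous values lets each value be chosen
    against a countable set. *)
Lemma wf_rec_set {d : Order.disp_t} {W : orderType d} (T : Type)
    (Phi : W -> set T -> T) :
  well_founded (fun u v : W => (u < v)%O) ->
  exists t : W -> T, forall u, t u = Phi u (t @` below u).
Proof.
move=> wf.
pose rec u (g : forall v, (v < u)%O -> T) :=
  Phi u [set z | exists v (vu : (v < u)%O), g v vu = z].
exists (Fix wf (fun _ => T) rec) => u; rewrite Fix_eq => [|v g h gh].
  congr Phi; apply/seteqP; split=> z /=; first by move=> [v [vu <-]]; exists v.
  by move=> [v vu <-]; exists v, vu.
by congr rec; apply: functional_extensionality_dep => w;
  apply: functional_extensionality_dep.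
Qed.

End Uncountable.

Section DeltaSystem.
Context {d : Order.disp_t} {W : orderType d}.
Local Open Scope classical_set_scope.
Implicit Types (A B : set {fset W}).

Lemma Delta_system_sub A B : A `<=` B -> Delta_system B -> Delta_system A.
Proof. by move=> AB [r rP]; exists r => a b /AB Ba /AB; exact: rP. Qed.

Let disjoint_system A := forall a b, A a -> A b -> a != b ->
  (a `&` b)%fset = fset0.

(** A maximal disjoint subfamily that is countable has a countable union, which
    every member of A meets; A is then a countable union of countable families.
*)
Let disjoint_subsystem A : (forall x, countable (A `&` [set a | x \in a])) ->
  (forall a, A a -> a != fset0) -> ~ countable A ->
  exists B, [/\ B `<=` A, ~ countable B & disjoint_system B].
Proof.
move=> cx A0 uA.
have [F FP tF|M [[MA Md] Mmax]] :=
    @Zorn_bigcup _ [set B | B `<=` A /\ disjoint_system B].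
  split=> [a [B FB Ba]|a b [B FB Ba] [C FC Cb] ab].
    by have [BA _] := FP _ FB; exact: BA.
  have [BC|CB] := tF B C FB FC.
    by have [_ Cd] := FP _ FC; apply: Cd => //; exact: BC.
  by have [_ Bd] := FP _ FB; apply: Bd => //; exact: CB.
exists M; split=> // cM; apply: uA.
pose U := \bigcup_(m in M) [set` m].
have cU : countable U.
  by apply: bigcup_countable => // m _; exact/finite_set_countable/finite_fset.
apply: countable_sub (_ : countable (\bigcup_(x in U) (A `&` [set a | x \in a]))).
  move=> a Aa; suff [x xa Ux] : exists2 x, x \in a & U x by exists x.
  apply: contrapT => /forall2NP aU.
  have aM x : x \in a -> forall m, M m -> x \notin m.
    move=> xa m Mm; apply/negP => xm; have [//|] := aU x.
    by apply; exists m.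
  have [x xa] : exists x, x \in a by apply/fset0Pn/A0.
  apply: (Mmax (M `|` [set a])).
    split; first by move=> m Mm; left.
    by move=> /(_ a (or_intror erefl)) /(aM x xa); rewrite xa.
  split; first by move=> m [/MA//|->].
  have dj m : M m -> (a `&` m)%fset = fset0.
    move=> Mm; apply/fsetP=> z; rewrite in_fsetI inE.
    by case: (boolP (z \in a)) => // /aM/(_ m Mm)/negbTE->.
  move=> m m' [Mm|->] [Mm'|->] mm'; first exact: Md.
  - by rewrite fsetIC dj.
  - exact: dj.
  - by rewrite eqxx in mm'.
exact: bigcup_countable.
Qed.

Let Delta_subsystem_size n A : (forall a, A a -> #|` a|%fset = n) ->
  ~ countable A -> exists B, [/\ B `<=` A, ~ countable B & Delta_system B].
Proof.
elim: n A => [|n IH] A sA uA.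
  case: uA; apply: countable_sub (_ : countable [set fset0]).
    by move=> a /sA /eqP; rewrite cardfs_eq0 => /eqP.
  exact: countable1.
have [cx|/existsNP[x ux]] := pselect (forall x, countable (A `&` [set a | x \in a])).
  have [|B [BA uB Bd]] := disjoint_subsystem cx _ uA.
    by move=> a /sA; rewrite -cardfs_gt0 => ->.
  by exists B; split=> //; exists fset0.
set C := A `&` _ in ux.
have Cx a : C a -> (x |` (a `\ x))%fset = a.
  by move=> [_ xa]; rewrite fsetD1K.
have [| |B [BC uB [r rP]]] := IH ((fun a => a `\ x)%fset @` C).
- move=> _ [a [Aa xa] <-]; apply/eqP.
  by rewrite -eqSS -(sA a Aa) (cardfsD1 x a) xa.
- apply: contra_not ux; apply: countable_im_inj => a b.
  by rewrite !inE => /Cx aE /Cx bE ab; rewrite -aE ab bE.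
exists (C `&` [set a | B (a `\ x)%fset]); split.
- by move=> a [[]].
- apply: contra_not uB => /(countable_im (fun a => a `\ x)%fset).
  apply: countable_sub => b Bb; have [a Ca ab] := BC b Bb.
  by exists a => //; split=> //=; rewrite ab.
- exists (x |` r)%fset => a b [Ca Ba] [Cb Bb] ab.
  rewrite -(rP _ _ Ba Bb); last first.
    by apply: contra_neq ab => E; rewrite -(Cx a Ca) E Cx.
  by rewrite -{1}(Cx a Ca) -{1}(Cx b Cb) fsetUIr.
Qed.

(** For sets of size n+1: if uncountably many share a point, remove it and use
    induction; if no point is shared so often, uncountably many are disjoint. *)
Lemma Delta_system_lemma A : ~ countable A ->
  exists B, [/\ B `<=` A, ~ countable B & Delta_system B].
Proof.
move=> /(uncountable_fibre (fun a => #|` a|%fset))[n uA].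
have [|B [BA uB Bd]] := Delta_subsystem_size (n := n) _ uA; first by move=> a [].
by exists B; split=> // a /BA[].
Qed.

End DeltaSystem.

(** * Two compatible conditions in an uncountable family *)

Section Pairs.
Context {d : Order.disp_t} {W : orderType d}.
Local Open Scope classical_set_scope.

Let enumS (A : {fset W}) : seq W := sort <=%O A.

Let mem_enumS (A : {fset W}) x : (x \in enumS A) = (x \in A).
Proof. by rewrite mem_sort. Qed.

Let enumS_imfset (A B : {fset W}) (e : W -> W) :
  {in A &, {homo e : x y / (x < y)%O}} -> [fset e x | x in A]%fset = B ->
  enumS B = [seq e x | x <- enumS A].
Proof.
move=> eh EB; apply: le_sorted_eq.
- exact: sort_le_sorted.
- have eh' : {in A &, {homo e : x y / (x <= y)%O}}.
    move=> x y xA yA; rewrite le_eqVlt => /predU1P[->//|xy].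
    by apply/ltW/eh.
  apply: (homo_sorted_in eh'); last exact: sort_le_sorted.
  by apply/allP=> x; rewrite mem_enumS.
- apply: uniq_perm.
  + by rewrite sort_uniq fset_uniq.
  + rewrite map_inj_in_uniq ?sort_uniq ?fset_uniq // => x y.
    rewrite !mem_enumS => xA yA exy; have [xy|yx|//] := ltgtP x y.
      by have := eh _ _ xA yA xy; rewrite exy ltxx.
    by have := eh _ _ yA xA yx; rewrite exy ltxx.
  + move=> y; rewrite mem_enumS -EB; apply/imfsetP/mapP => /= -[x xA ->];
    by exists x; rewrite ?mem_enumS // -mem_enumS.
Qed.

Variables (f : {fset W} -> set W) (n : nat).

(** What an order isomorphism of the domains has to preserve, read along their
    increasing enumerations.  The index al is marked as a point of the domain:
    this makes the isomorphism take index to index, so that a map moving points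
    up goes from the smaller index to the larger, and makes distinct indices
    with the same code have distinct domains. *)
Let code (al : W) (p : cond f) (x : 'I_n -> option W) :=
  let l := enumS (cD p) in
  ([seq u == al | u <- l], [seq [seq u \in ch p v | u <- l] | v <- l],
   [seq [seq x i == Some u | u <- l] | i <- ord_enum n],
   [seq x i == None | i <- ord_enum n]).

Let code_eq al be p q x y (e : W -> W) :
  enumS (cD q) = [seq e u | u <- enumS (cD p)] ->
  code al p x = code be q y ->
  [/\ forall u, u \in cD p -> (u == al) = (e u == be),
      forall u v, u \in cD p -> v \in cD p ->
        (u \in ch p v) = (e u \in ch q (e v)),
      forall i u, u \in cD p -> (x i == Some u) = (y i == Some (e u))
    & forall i, (x i == None) = (y i == None)].
Proof.
rewrite /code => ->; rewrite -!map_comp => -[/eq_in_map H1 /eq_in_map H2 H3 /eq_in_map H4].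
split=> [u up|u v up vp|i u up|i].
- by apply: H1; rewrite mem_enumS.
- have /= := H2 v; rewrite mem_enumS => /(_ vp); rewrite -map_comp => /eq_in_map.
  by move=> /(_ u); rewrite mem_enumS => /(_ up).
- move/eq_in_map: H3 => /(_ i); rewrite mem_ord_enum => /(_ isT) /=.
  by rewrite -map_comp => /eq_in_map /(_ u); rewrite mem_enumS => /(_ up).
- by apply: H4; rewrite mem_ord_enum.
Qed.

Hypothesis hfc : countable_valued f.
Hypothesis hf : strong_property_Delta f.

Variables (S : set W) (p : W -> cond f) (x : W -> 'I_n -> option W).
Hypothesis uS : ~ countable S.
(* the clauses of the strong property Delta are quantified over the points of
   the root, and say nothing when the root is empty: w0 keeps it inhabited *)
Variable w0 : W.
Hypothesis Sw : forall al, S al -> w0 \in cD (p al).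
Hypothesis Sp : forall al, S al -> al \in cD (p al).
Hypothesis Sx : forall al i u, S al -> x al i = Some u -> u \in cD (p al).

(** The values of i on the root are finite subsets of the countable set of
    values of f on pairs from r. *)
Let agree_on_root (r : {fset W}) (T : set W) : ~ countable T ->
  exists2 T', ~ countable (T `&` T') & forall al be, T al -> T be -> T' al ->
    T' be -> forall u v, u \in r -> v \in r ->
    u \in cD (p al) -> u \in cD (p be) -> v \in cD (p al) -> v \in cD (p be) ->
    (u < v)%O -> ci (p al) [fset u; v]%fset = ci (p be) [fset u; v]%fset.
Proof.
move=> uT.
pose C := \bigcup_(u in [set` r]) \bigcup_(v in [set v | v \in r /\ u != v])
  f [fset u; v]%fset.
have cC : countable C.
  have cr : countable [set` r] by exact/finite_set_countable/finite_fset.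
  apply: bigcup_countable => // u _; apply: bigcup_countable => [|v [_ uv]].
    by apply: countable_sub cr => v [].
  exact: hfc.
have /countable_injP[g gi] := cC.
pose code2 al := [seq [seq [seq g z | z <- (ci (p al) [fset u; v]%fset : seq W)]
  | v <- r] | u <- r].
have [k uk] := uncountable_fibre code2 uT.
exists [set al | code2 al = k] => // al be Tal Tbe /= kal kbe u v ur vr ua ub va vb uv.
have : code2 al = code2 be by rewrite kal kbe.
move=> /eq_in_map/(_ u ur)/eq_in_map/(_ v vr) E.
have inC ga z : u \in cD (p ga) -> v \in cD (p ga) ->
    z \in ci (p ga) [fset u; v]%fset -> z \in C.
  move=> uga vga zi; rewrite inE; exists u => //; exists v.
    by split=> //; rewrite lt_eqF.
  exact: mem_ci_f zi.
have sub ga de : u \in cD (p ga) -> v \in cD (p ga) -> u \in cD (p de) ->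
    v \in cD (p de) ->
    [seq g z | z <- (ci (p ga) [fset u; v]%fset : seq W)] =
    [seq g z | z <- (ci (p de) [fset u; v]%fset : seq W)] ->
    forall z, z \in ci (p ga) [fset u; v]%fset ->
      z \in ci (p de) [fset u; v]%fset.
  move=> uga vga ude vde E' z zi.
  have : g z \in [seq g z | z <- (ci (p de) [fset u; v]%fset : seq W)].
    by rewrite -E'; apply: map_f.
  case/mapP=> z' z'i gz; have -> // : z = z'.
  by apply: gi => //; [exact: inC zi|exact: inC z'i].
by apply/fsetP=> z; apply/idP/idP; apply: sub.
Qed.

(** Codes and the values of i on the root become constant after thinning out, so
    that [amalgamation] applies to the two domains given by the strong property
    Delta; the marked indices put these in increasing order. *)
Lemma compatible_pair : exists al be (e : W -> W) (s : cond f),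
  [/\ [/\ S al, S be & (al < be)%O], cond_le s (p al), cond_le s (p be),
      forall i, x be i = omap e (x al i)
    & forall u v, u \in cD (p al) -> v \in cD (p be) ->
        (u \in ch s v) = (e u \in ch (p be) v)].
Proof.
have [k uS1] := uncountable_fibre (fun al => code al (p al) (x al)) uS.
set S1 := S `&` _ in uS1.
pose D al := cD (p al).
have S1c al be : S1 al -> S1 be -> code al (p al) (x al) = code be (p be) (x be).
  by move=> [_ /= ->] [_ /= ->].
have Dinj : {in S1 &, injective D}.
  move=> al be; rewrite !inE => Sal Sbe E.
  have [|H _ _ _] := code_eq (e := id) _ (S1c _ _ Sal Sbe).
    by rewrite map_id; congr enumS.
  by apply/eqP; rewrite -H ?eqxx //; apply: Sp; case: Sal.
have uDS T : T `<=` S1 -> ~ countable T -> ~ countable (D @` T).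
  move=> TS uT; apply: contra_not uT; apply: countable_im_inj => al be.
  by rewrite !inE => /TS Ta /TS Tb; apply: Dinj; rewrite inE.
have [A2 [A2sub uA2 A2d]] := Delta_system_lemma (uDS _ (@subset_refl _ _) uS1).
have [r rP] := A2d.
pose T := S1 `&` [set al | A2 (D al)].
have uT : ~ countable T.
  apply: contra_not uA2 => /(countable_im D); apply: countable_sub => a Aa.
  by have [al Sal E] := A2sub a Aa; exists al => //; split=> //=; rewrite E.
have [T' uT' T'P] := agree_on_root r uT.
have TS1 : T `&` T' `<=` S1 by move=> al [[]].
have DT : Delta_system (D @` (T `&` T')).
  by apply: Delta_system_sub A2d => _ [al [[_ /= Aal] _] <-].
have [_ /(_ _ (uDS _ TS1 uT') DT)] := hf.
move=> [_ [_ [[al Tal <-] [be Tbe <-] ab [e [eh eim eid ege eD]]]]].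
have [Sal Sbe] : S1 al /\ S1 be by split; exact: TS1.
have [SSal SSbe] : S al /\ S be by case: Sal; case: Sbe.
have [H1 H2 H3 H4] := code_eq (enumS_imfset eh eim) (S1c _ _ Sal Sbe).
have ebe : e al = be by apply/eqP; rewrite -H1 ?eqxx // Sp.
have albe : (al < be)%O.
  rewrite lt_neqAle -{2}ebe ege ?Sp // andbT.
  by apply: contra_neq ab => ->.
have rI : (D al `&` D be)%fset = r.
  by apply: rP => //; [case: Tal => [[]]|case: Tbe => [[]]].
have fmin := hf.1.
have ci_lt u v : u \in D al -> u \in D be -> v \in D al -> v \in D be ->
    (u < v)%O -> ci (p al) [fset u; v]%fset = ci (p be) [fset u; v]%fset.
  move=> ua ub va vb uv; have [[Tal1 Tal2] [Tbe1 Tbe2]] := (Tal, Tbe).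
  by apply: T'P => //; rewrite -rI in_fsetI ?ua ?va.
have [||||||s [sp sq sE]] := @amalgamation _ _ _ (p al) (p be) e fmin.
- by move=> u ua ub; apply: eid; rewrite in_fsetI ua.
- exact: ege.
- exact: H2.
- move=> u v ua ub va vb; rewrite neq_lt => /orP[uv|vu]; first exact: ci_lt.
  by rewrite fsetUC; apply: ci_lt.
- move=> u v ua ub vb va.
  by have [] := eD w0 u v; rewrite ?in_fsetI ?in_fsetD ?Sw // ?ua ?ub ?va ?vb.
- move=> t u v ta tb ua ub vb va tu.
  have [|||_ cl2 _] := eD t u v; last exact: cl2.
  + by rewrite in_fsetI ta.
  + by rewrite in_fsetD ub.
  + by rewrite in_fsetD va.
exists al, be, e, s; split=> // i.
have [xN|] := eqVneq (x al i) None; first by apply/eqP; rewrite xN /= -H4 xN.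
case E: (x al i) => [u|//] _ /=; apply/eqP; rewrite -H3 ?E //.
exact: Sx E.
Qed.

End Pairs.

(** * The forcing relation *)

Section ForcingRelation.
Context {P : Type} {le : P -> P -> Prop}.
Hypothesis le_refl : forall p, le p p.
Hypothesis le_trans : forall q p r, le p q -> le q r -> le p r.
Implicit Types (F G : @fprop P).

Lemma fimpE F G p :
  fimp le F G p <-> forall q, le q p -> F q -> exists2 r, le r q & G r.
Proof.
split=> H q qp.
  by move=> Fq; apply: contrapT => /forall2NP nG; apply: (H q qp); split=> // r rq;
    case: (nG r).
by case=> Fq nG; have [r rq /(nG r rq)] := H q qp Fq.
Qed.

Lemma fexE (A : Type) (F : A -> @fprop P) p :
  fex le F p <-> forall q, le q p -> exists a, exists2 r, le r q & F a r.
Proof.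
split=> H q qp.
  apply: contrapT => /forallNP nF; apply: (H q qp) => a r rq Far.
  by apply: (nF a); exists r.
by have [a [r rq Far]] := H q qp => nF; exact: (nF a r rq).
Qed.

Lemma fnot_mono F p q : le q p -> fnot le F p -> fnot le F q.
Proof. by move=> qp nF r rq; apply: nF; exact: le_trans qp. Qed.

Lemma fimp_mono F G p q : le q p -> fimp le F G p -> fimp le F G q.
Proof. exact: fnot_mono. Qed.

Lemma fmem_mono X (x : X) A p q : le q p -> fmem le x A p -> fmem le x A q.
Proof. by move=> qp xA r rq; apply: xA; exact: le_trans qp. Qed.

Lemma fmem_dense X (x : X) A p :
  (forall q, le q p -> exists2 r, le r q & fmem le x A r) -> fmem le x A p.
Proof.
move=> H q qp; have [r rq xA] := H q qp.
by have [s sr sP] := xA r (le_refl r); exists s => //; exact: le_trans rq.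
Qed.

Lemma fmem_intro X (x : X) (A : name X) p : A x p -> fmem le x A p.
Proof. by move=> Axp q qp; exists q; [exact: le_refl|exists x, p]. Qed.

Lemma fmem_elim X (x : X) (A : name X) p : fmem le x A p ->
  exists2 q, le q p & exists2 r, A x r & le q r.
Proof.
move=> /(_ p (le_refl p))[q qp [b [r [Abr qr]]]]; rewrite /feq /fground => ->.
by exists q => //; exists r.
Qed.

Lemma feq_set_refl X (A : name X) p : feq_set le A A p.
Proof. by move=> x; split; apply/fimpE => q _ xA; exists q. Qed.

Lemma feq_set_fmem X (A B : name X) (x : X) p q : feq_set le A B p ->
  le q p -> fmem le x B q -> fmem le x A q.
Proof.
move=> /(_ x)[_ /fimpE BA] qp xB; apply: fmem_dense => r rq.
by apply: BA; [exact: le_trans qp|exact: fmem_mono xB].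
Qed.

Lemma feq_set_fmemC X (A B : name X) (x : X) p q : feq_set le A B p ->
  le q p -> fmem le x A q -> fmem le x B q.
Proof.
move=> /(_ x)[/fimpE AB _] qp xA; apply: fmem_dense => r rq.
by apply: AB; [exact: le_trans qp|exact: fmem_mono xA].
Qed.

Lemma fmem_set_elim X (A : name X) S p : fmem_set le A S p ->
  exists2 q, le q p & exists2 B, (exists2 r, S B r & le q r) & feq_set le A B q.
Proof.
move=> /(_ p (le_refl p))[q qp [B [r [SBr qr AB]]]].
by exists q => //; exists B => //; exists r.
Qed.

Lemma fmem_set_intro X (A : name X) (S : name (name X)) p :
  S A p -> fmem_set le A S p.
Proof.
move=> SAp q qp; exists q; first exact: le_refl.
by exists A, p; split=> //; exact: feq_set_refl.
Qed.

Lemma fmem_set_sub X (A : name X) (S T : name (name X)) p :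
  (forall B r, S B r -> T B r) -> fmem_set le A S p -> fmem_set le A T p.
Proof.
move=> ST AS q qp; have [q' q'q [B [r [SBr q'r AB]]]] := AS q qp.
by exists q' => //; exists B, r; split=> //; exact: ST.
Qed.

Lemma subbasic_open X (S : name (name X)) A p :
  fmem_set le A S p -> generated_topology le S A p.
Proof.
move=> AS x; apply/fimpE => q qp xA; exists q; first exact: le_refl.
apply/fexE => r rq; exists 1; exists r; first exact: le_refl.
apply/fexE => s sr; exists (fun _ => A); exists s; first exact: le_refl.
have sq := le_trans sr rq.
split; [move=> _|split; [move=> _|move=> y]].
- by move=> t ts; apply: AS; apply: le_trans qp; apply: le_trans sq.
- exact: fmem_mono xA.
- by apply/fimpE => t _ yA; exists t => //; exact: (yA ord0).
Qed.

(** The requirements are met one after the other; persistence keeps the earlier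
    ones. *)
Lemma dense_family n (T : Type) (t0 : T) (Q : 'I_n -> P -> T -> Prop) p0 :
  (forall i p q t, le q p -> Q i p t -> Q i q t) ->
  (forall i p, le p p0 -> exists2 q, le q p & exists t, Q i q t) ->
  exists2 q, le q p0 & exists t : 'I_n -> T, forall i, Q i q (t i).
Proof.
move=> Qmono Qd.
suff H (l : seq 'I_n) :
    exists2 q, le q p0 & exists t, forall i, i \in l -> Q i q (t i).
  have [q qp [t tP]] := H (ord_enum n).
  by exists q => //; exists t => i; apply: tP; rewrite mem_ord_enum.
elim: l => [|i l [q qp0 [t tP]]].
  by exists p0 => //; exists (fun _ => t0).
have [r rq [u uP]] := Qd i q qp0.
exists r; first exact: le_trans qp0.
exists (fun j => if j == i then u else t j) => j; rewrite inE.
by case: eqP => [->//|_ /= /tP]; exact: Qmono.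
Qed.

(** A ground model injection of C into omega still works in the extension. *)
Lemma countable_range_name X (A : name X) (C : set X) p : countable C ->
  (forall x r, A x r -> C x) -> fcountable le A p.
Proof.
move=> /countable_injP[c c_inj] AC; apply/fexE => q _.
exists (fun xk _ => C xk.1 /\ xk.2 = c xk.1); exists q; first exact: le_refl.
split; [|split].
- move=> x; apply/fimpE => r _ H; have [s sr [t Axt _]] := fmem_elim H.
  have Cx := AC _ _ Axt.
  exists s => //; apply/fexE => u _; exists (c x); exists u => //.
  exact: fmem_intro.
- move=> x k l; apply/fimpE => r _ H; have [s sr [s' [/= _ kx] _]] := fmem_elim H.
  exists s => //; apply/fimpE => t _ H'; have [u ut [u' [/= _ lx] _]] := fmem_elim H'.
  by exists u => //; rewrite /feq /fground kx lx.
- move=> x y k; apply/fimpE => r _ H; have [s sr [s' [/= Cx kx] _]] := fmem_elim H.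
  exists s => //; apply/fimpE => t _ H'; have [u ut [u' [/= Cy ky] _]] := fmem_elim H'.
  by exists u => //; apply: c_inj; rewrite ?inE // -kx.
Qed.

End ForcingRelation.

(** * Local bases of the space *)

Section LocalBases.
Context {d : Order.disp_t} {W : orderType d} {f : {fset W} -> set W}.
Implicit Types (p q r s : cond f) (u v w g : W) (z y : option W).
Local Open Scope classical_set_scope.

Local Notation le := (@cond_le d W f).
Local Notation name := (@name (cond f)).

Definition avoids s (F : {fset W}) v := all (fun g => v \notin ch s g) F.

(** s puts y into the basic neighbourhood of z given by F: h(z) minus the union
    of the h(g), g in F, where h(z) is the whole space if z is infinity. *)
Definition in_box s z (F : {fset W}) y : bool :=
  if y is Some v then
    (if z is Some u then v \in ch s u else true) && avoids s F v
  else ~~ isSome z.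

Definition supports p z : Prop := forall u, z = Some u -> u \in cD p.

Lemma supports_le p q z : cond_le q p -> supports p z -> supports q z.
Proof. by move=> qp pz u /pz; exact: cond_le_cD. Qed.

Lemma avoids_le p q (F : {fset W}) v : cond_le q p -> (F `<=` cD p)%fset ->
  v \in cD p -> avoids q F v = avoids p F v.
Proof.
move=> qp /fsubsetP Fp vp; apply: eq_in_all => g gF.
by rewrite (cond_le_ch qp) // Fp.
Qed.

Lemma in_box_le p q z (F : {fset W}) y : cond_le q p -> supports p z ->
  (F `<=` cD p)%fset -> supports p y -> in_box q z F y = in_box p z F y.
Proof.
move=> qp pz Fp; case: y => [v|//] /(_ v erefl) vp.
rewrite /in_box (avoids_le qp) //; case: z pz => [u /(_ u erefl) up|//].
by rewrite (cond_le_ch qp).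
Qed.

Lemma fmem_hdot s u v : u \in cD s -> v \in ch s u -> fmem le v (hdot u) s.
Proof. by move=> us vu; apply: fmem_intro; [exact: cond_le_refl|]. Qed.

Lemma fmem_hdot_elim p u v : fmem le v (hdot u) p ->
  exists2 q, cond_le q p & [/\ u \in cD q, v \in cD q & v \in ch q u].
Proof.
move=> H; have [q qp [r [ur vu] qr]] := fmem_elim (@cond_le_refl _ _ _) H.
have vr : v \in cD r by exact: fsubsetP (ch_sub ur) v vu.
exists q => //; split; try exact: cond_le_cD qr _.
by rewrite (cond_le_ch qr).
Qed.

Lemma fmem_hdotC s u v : u \in cD s -> v \in cD s -> v \notin ch s u ->
  fmem le v (fcompl le (hdot u)) s.
Proof.
move=> us vs vu; apply: fmem_intro; first exact: cond_le_refl.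
move=> q qs H; have [r rq [_ _]] := fmem_hdot_elim H.
by rewrite (cond_le_ch (cond_le_trans rq qs)) // (negbTE vu).
Qed.

Lemma fmem_hdotC_elim p u v : fmem le v (fcompl le (hdot u)) p ->
  exists2 q, cond_le q p & [/\ u \in cD q, v \in cD q & v \notin ch q u].
Proof.
move=> H; have [q qp [r rN qr]] := fmem_elim (@cond_le_refl _ _ _) H.
have [s sq us] := cond_dense_cD q u; have [t ts vt] := cond_dense_cD s v.
have ut := cond_le_cD ts us; have tq := cond_le_trans ts sq.
exists t; first exact: cond_le_trans qp.
split=> //; apply/negP => vu; apply: (rN t); first exact: cond_le_trans qr.
exact: fmem_hdot.
Qed.

(** The first two clauses make p decide which of its points are in the box. *)
Definition box_in (U : name (option W)) z p (F : {fset W}) : Prop :=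
  [/\ supports p z, (F `<=` cD p)%fset, in_box p z F z &
      forall s y, cond_le s p -> supports s y -> in_box s z F y ->
        fmem le y U s].

Lemma box_in_le U z p q F : cond_le q p -> box_in U z p F -> box_in U z q F.
Proof.
move=> qp [zp Fp zF H]; split.
- exact: supports_le zp.
- by apply: fsubset_trans Fp _; case: qp.
- by rewrite (in_box_le qp).
- by move=> s y sq; apply: H; exact: cond_le_trans qp.
Qed.

Definition box_inL (U : name W) u p (F : {fset W}) : Prop :=
  [/\ u \in cD p, (F `<=` cD p)%fset, avoids p F u &
      forall s v, cond_le s p -> v \in cD s -> v \in ch s u -> avoids s F v ->
        fmem le v U s].

Lemma box_inL_le U u p q F : cond_le q p -> box_inL U u p F -> box_inL U u q F.
Proof.
move=> qp [up Fp uF H]; split.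
- exact: cond_le_cD up.
- by apply: fsubset_trans Fp _; case: qp.
- by rewrite (avoids_le qp).
- by move=> s y sq; apply: H; exact: cond_le_trans qp.
Qed.

Lemma fmem_open_some (U : name (option W)) u p :
  fmem le (Some u) U p <-> fmem le u (fun x => U (Some x)) p.
Proof.
split=> H q /H[r rq [b [t [Ubt rt E]]]]; exists r => //.
  have E' : Some u = b := E.
  by exists u, t; split=> //; rewrite E'.
have E' : u = b := E.
by exists (Some u), t; split=> //; rewrite E'.
Qed.

Hypothesis fmin : forall u v, u != v ->
  f [fset u; v]%fset `<=` below (Order.min u v).

(** If u < w then F = i{u, w}: its elements are below u, so u is in none of their
    sets h(g), and clause (a), which persists below p because i does, covers
    h(u) minus h(w). *)
Lemma box_inL_hdot u w p : fmem le u (hdot w) p ->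
  exists2 q, cond_le q p & exists F, box_inL (hdot w) u q F.
Proof.
move=> /fmem_hdot_elim[q qp [wq uq uw]]; exists q => //.
have := ch_le wq uw; rewrite le_eqVlt => /predU1P[<-|ltuw].
  exists fset0; split=> [//||//|s v sq vs vu _]; first exact: fsub0set.
  by apply: fmem_hdot => //; exact: cond_le_cD uq.
exists (ci q [fset u; w]%fset); split=> //.
- exact: ci_sub.
- apply/allP => g gi; apply/negP => /(ch_le (mem_ci_cD uq wq ltuw gi)).
  have := fmin _ (mem_ci_f uq wq ltuw gi).
  rewrite lt_eqF // (min_l (ltW ltuw)) => /(_ isT); rewrite /below /= => gu.
  by rewrite leNgt gu.
- move=> s v sq vs vu /allP vF; have ws := cond_le_cD sq wq.
  apply: fmem_hdot => //; apply: contraT => vw.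
  have [|g] := mem_ci_in (cond_le_cD sq uq) ws ltuw _ vu vw.
    by rewrite (cond_le_ch sq).
  by case: (sq) => _ _ ->; rewrite ?lt_eqF // => /vF/negbTE->.
Qed.

Lemma box_inL_hdotC u w p : fmem le u (fcompl le (hdot w)) p ->
  exists2 q, cond_le q p & exists F, box_inL (fcompl le (hdot w)) u q F.
Proof.
move=> /fmem_hdotC_elim[q qp [wq uq uw]]; exists q => //.
exists [fset w]%fset; split=> //.
- by rewrite fsub1set.
- by apply/allP => g; rewrite in_fset1 => /eqP->.
- move=> s v sq vs vu /allP vF; apply: fmem_hdotC => //.
    exact: cond_le_cD wq.
  by apply: vF; rewrite in_fset1.
Qed.

Let refl := @cond_le_refl d W f.
Let trans := @cond_le_trans d W f.

Lemma box_inL_subbasis (V : name W) u p : fmem_set le V (@subbasis d W f) p ->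
  fmem le u V p -> exists2 q, cond_le q p & exists F, box_inL V u q F.
Proof.
move=> VS uV; have [q qp [B [_ [w wB] _] VB]] := fmem_set_elim refl VS.
have uB : fmem le u B q.
  apply: (feq_set_fmemC refl trans VB (refl q)); exact: (fmem_mono trans qp).
have [r rq [F [ur Fr uF H]]] : exists2 r, cond_le r q & exists F, box_inL B u r F.
  by case: wB uB => ->; [exact: box_inL_hdot|exact: box_inL_hdotC].
exists r; first exact: cond_le_trans qp.
exists F; split=> // s v sr vs vu vF.
have sq := trans sr rq.
by apply: (feq_set_fmem refl trans VB sq); exact: H.
Qed.

Lemma box_inL_open (U : name W) u p : @L_space d W f U p -> fmem le u U p ->
  exists2 q, cond_le q p & exists F, box_inL U u q F.
Proof.
move=> HU uU; have [p' p'p up'] := cond_dense_cD p u.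
have := HU u => /fimpE/(_ p' p'p (fmem_mono trans p'p uU))[q qp'].
move=> /fexE/(_ q (refl q))[n [r rq]] /fexE/(_ r (refl r))[V [s sr [VS [uV VU]]]].
have [|i t ts|t ts [F FP]] :=
    dense_family refl trans fset0 (Q := fun i t F => box_inL (V i) u t F) (p0 := s).
- by move=> i t t' F; exact: box_inL_le.
- apply: box_inL_subbasis; last exact: (fmem_mono trans ts (uV i)).
  by move=> t' t't; apply: VS; exact: trans ts.
pose G := (\bigcup_(i <- ord_enum n) F i)%fset.
have FG i : (F i `<=` G)%fset.
  by apply/fsubsetP => g gF; apply/bigfcupP; exists i; rewrite ?mem_ord_enum.
have inG g : g \in G -> exists i, g \in F i by case/bigfcupP => i _; exists i.
exists t; first by apply: trans p'p; apply: trans qp'; apply: trans rq; apply: trans sr.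
have tp' : cond_le t p' by apply: trans qp'; apply: trans rq; apply: trans sr.
exists G; split.
- exact: cond_le_cD up'.
- apply/fsubsetP => g /inG[i gi]; have [_ /fsubsetP Ft _ _] := FP i; exact: Ft.
- apply/allP => g /inG[i gi]; have [_ _ /allP uF _] := FP i; exact: uF.
- move=> s' v s't vs' vu /allP vG; apply: (fmem_dense refl trans) => a as'.
  have as_ : cond_le a s by apply: trans as' _; apply: trans s't _.
  have := VU v => /fimpE/(_ a as_); apply => i.
  apply: (fmem_mono trans as'); have [_ _ _] := FP i; apply=> //.
  by apply/allP => g gi; apply: vG; exact: fsubsetP (FG i) g gi.
Qed.

(** The sets h(w) are an open cover of the compact complement of U; the indices
    of a finite subcover form F. *)
Lemma box_in_open_infty (U : name (option W)) p : K_space f U p ->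
  fmem le None U p -> exists2 q, cond_le q p & exists F, box_in U None q F.
Proof.
move=> [_ /fimpE/(_ p (refl p)) H] NU; have [r rp cpt] := H NU.
pose S0 : @Defs.name (cond f) (name W) := fun A _ => exists w, A = hdot w.
have /fimpE/(_ r (refl r))[|r1 r1r /fimpE/(_ r1 (refl r1))[|r2 r21]] := cpt S0.
- move=> V; apply/fimpE => q qr VS; exists q; first exact: refl.
  apply: (subbasic_open refl trans).
  by apply: fmem_set_sub VS => B b [w ->]; exists w; left.
- move=> v; apply/fimpE => q qr1 _; have [s sq vs] := cond_dense_cD q v.
  exists s => //; apply/fexE => t ts; exists (hdot v); exists t; first exact: refl.
  split; first by apply: (fmem_set_intro refl); exists v.
  by apply: fmem_hdot; [|apply: mem_ch_self]; exact: cond_le_cD vs.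
move=> /fexE/(_ r2 (refl r2))[n [r3 r32]] /fexE/(_ r3 (refl r3))[V [s sr3 [VS cov]]].
pose Q i t F := (F `<=` cD t)%fset /\ forall s v, cond_le s t -> v \in cD s ->
  avoids s F v -> fnot le (fmem le v (V i)) s.
have [|i t ts|t ts [F FP]] := dense_family refl trans fset0 (Q := Q) (p0 := s).
- move=> i t t' F t't [Ft H']; split.
    by apply: fsubset_trans Ft _; case: t't.
  by move=> a v at'; apply: H'; exact: trans t't.
- have [q qt [B [_ [w wB] _] VB]] :=
    fmem_set_elim refl (fun a (at_ : cond_le a t) => VS i a (trans at_ ts)).
  have [q' q'q wq'] := cond_dense_cD q w.
  exists q'; first exact: trans qt.
  exists [fset w]%fset; split; first by rewrite fsub1set.
  move=> a v aq' va /allP/(_ w); rewrite in_fset1 eqxx => /(_ isT) vw b ba vV.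
  have bq : cond_le b q by apply: trans q'q; apply: trans aq'.
  have := feq_set_fmemC refl trans VB bq vV; rewrite wB.
  move=> /fmem_hdot_elim[e eb [_ _]].
  by rewrite (cond_le_ch (trans eb ba)) ?(negbTE vw) //; exact: cond_le_cD wq'.
pose G := (\bigcup_(i <- ord_enum n) F i)%fset.
have FG i : (F i `<=` G)%fset.
  by apply/fsubsetP => g gF; apply/bigfcupP; exists i; rewrite ?mem_ord_enum.
have tr : cond_le t r.
  by apply: trans r1r; apply: trans r21; apply: trans r32; apply: trans sr3.
exists t; first exact: trans rp.
exists G; split=> //.
  by apply/fsubsetP => g /bigfcupP[i _ gi]; have [/fsubsetP Ft _] := FP i; exact: Ft.
move=> a y at_ sy; case: y sy => [v /(_ v erefl) va|_ _]; last first.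
  by apply: (fmem_mono trans _ NU); apply: trans rp; exact: trans tr.
rewrite /in_box /= => /allP vG.
apply: (fmem_dense refl trans) => b ba; apply: contrapT => /forall2NP nU.
have vC : fmem le v (fcompl le (fun x => U (Some x))) b.
  apply: (fmem_intro refl) => e eb /fmem_open_some vU.
  by case: (nU e).
have bs : cond_le b s by apply: trans ts; exact: trans at_.
have := cov v => /fimpE/(_ b bs vC)[e eb] /fexE/(_ e (refl e))[i [g ge vV]].
have [_ /(_ a v at_ va)] := FP i; apply; last exact: vV.
- by apply/allP => h hi; apply: vG; exact: fsubsetP (FG i) h hi.
- by apply: trans ba; exact: trans eb.
Qed.

End LocalBases.

(** * Hereditary separability of the powers *)

Section Powers.
Context {d : Order.disp_t} {W : orderType d} {f : {fset W} -> set W}.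
Implicit Types (p q r s : cond f).
Local Open Scope classical_set_scope.

Local Notation le := (@cond_le d W f).
Local Notation name := (@name (cond f)).
Let refl := @cond_le_refl d W f.
Let trans := @cond_le_trans d W f.

Hypothesis fmin : forall u v, u != v ->
  f [fset u; v]%fset `<=` below (Order.min u v).

Lemma box_in_open (U : name (option W)) z p : K_space f U p -> fmem le z U p ->
  exists2 q, cond_le q p & exists F, box_in U z q F.
Proof.
case: z => [u|]; last exact: box_in_open_infty.
move=> [LU _] /fmem_open_some uU.
have [q qp [F [uq Fq uF H]]] := box_inL_open fmin LU uU.
exists q => //; exists F; split=> //.
- by move=> _ [<-].
- by rewrite /in_box mem_ch_self.
- move=> s [v|//] sq /(_ v erefl) vs /andP[vu vF].
  by apply/fmem_open_some/H.
Qed.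

Lemma K_space_mono (U : name (option W)) p q :
  cond_le q p -> K_space f U p -> K_space f U q.
Proof.
move=> qp [LU NU]; split; last exact: (fimp_mono trans qp).
by move=> u; apply: (fimp_mono trans qp); exact: LU.
Qed.

Variable n : nat.
Implicit Types (x y : 'I_n -> option W) (F : 'I_n -> {fset W}).

Definition in_boxes s x F y := forall i, in_box s (x i) (F i) (y i).

Definition pointed p x F := forall i,
  [/\ supports p (x i), (F i `<=` cD p)%fset & in_box p (x i) (F i) (x i)].

Lemma pointed_le p q x F : cond_le q p -> pointed p x F -> pointed q x F.
Proof.
move=> qp px i; have [xp Fp xF] := px i; split.
- exact: supports_le xp.
- by apply: fsubset_trans Fp _; case: qp.
- by rewrite (in_box_le qp).
Qed.

Lemma boxes_in_open (O : name ('I_n -> option W)) x p :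
  power_topology le (K_space f) (n:=n) O p -> fmem le x O p ->
  exists2 q, cond_le q p & exists2 F, pointed q x F &
    forall s y, cond_le s q -> (forall i, supports s (y i)) ->
      in_boxes s x F y -> exists2 r, cond_le r s & fmem le y O r.
Proof.
move=> /(_ x)/fimpE/(_ p (refl p)) H /H[q qp] /fexE/(_ q (refl q))[U [r rq [xU UO]]].
have [|i s sr|s sr [F FP]] :=
    dense_family refl trans fset0 (Q := fun i s G => box_in (U i) (x i) s G) (p0 := r).
- by move=> i s s' G; exact: box_in_le.
- have [oU xUi] := xU i; apply: box_in_open.
    exact: K_space_mono oU.
  exact: (fmem_mono trans sr).
exists s; first by apply: trans qp; exact: trans rq.
exists F => [i|a y at_ ya yF]; first by have [] := FP i.
have := UO y => /fimpE/(_ a (trans at_ sr)); apply=> i.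
by have [_ _ _] := FP i; apply.
Qed.

Let triple := (cond f * ('I_n -> option W) * ('I_n -> {fset W}))%type.

Variable Y : name ('I_n -> option W).
Variable q0 : cond f.

Definition good (t : triple) :=
  let: (p, x, F) := t in [/\ cond_le p q0, fmem le x Y p & pointed p x F].

(** Left separation, as the ground model sees it. *)
Definition separated (C : set triple) (t : triple) :=
  let: (p, x, F) := t in forall p' x' F', C (p', x', F') ->
    forall s, cond_le s p -> cond_le s p' -> ~ in_boxes s x F x'.

(** The points of the triples in C whose condition is in the generic filter. *)
Definition points_name (C : set triple) : name ('I_n -> option W) :=
  fun x p => exists F, C (p, x, F).

(** If an open set O meets Y, some condition puts a box around a point of O and Y
    inside O.  By maximality a point of C can be forced into that box, hence
    into O. *)
Lemma dense_points_name (C : set triple) : countable C -> C `<=` good ->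
  (forall t, good t -> ~ separated C t) ->
  fcountable le (points_name C) q0 /\
  fdense_in le (power_topology le (K_space f) (n:=n)) (points_name C) Y q0.
Proof.
move=> cC gC maxC; split.
  apply: (countable_range_name refl (C := (fun t => t.1.2) @` C)).
    exact: countable_im.
  by move=> x p [F Ct]; exists (p, x, F).
split.
  move=> x; apply/fimpE => q _ H.
  have [r rq [p [F /gC[_ xY _]] rp]] := fmem_elim refl H.
  by exists r => //; exact: (fmem_mono trans rp).
move=> O; apply/fimpE => q1 q10 oO; exists q1; first exact: refl.
apply/fimpE => q2 q21 OY; exists q2; first exact: refl.
apply/fexE => q3 q32; have /fexE/(_ q3 q32)[x [q4 q43 [xO xY]]] := OY.
have oO4 : power_topology le (K_space f) (n:=n) O q4.
  move=> y; apply: (fimp_mono trans (p := q1)); last exact: oO.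
  by apply: trans q21; exact: trans q32.
have [q5 q54 [F xF H]] := boxes_in_open oO4 xO.
have : ~ separated C (q5, x, F).
  apply: maxC; split=> //; last exact: (fmem_mono trans q54).
  by apply: trans q10; apply: trans q21; apply: trans q32; exact: trans q43.
move=> /existsNP[p' /existsNP[x' /existsNP[F' /not_implyP[Ct]]]].
move=> /existsNP[s /not_implyP[s5 /not_implyP[sp' /contrapT sx']]].
have [_ _ px'] := gC _ Ct.
have [|r rs x'O] := H s x' s5 _ sx'.
  by move=> i; have [x'p _ _] := px' i; exact: supports_le x'p.
exists x', r; first by apply: trans q43; apply: trans q54; exact: trans s5.
split=> //; apply: (fmem_mono trans (p := p')); first exact: trans sp'.
by apply: (fmem_intro refl); exists F'.
Qed.

Lemma good_extend p x F (A : {fset W}) (C : set triple) :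
  good (p, x, F) -> separated C (p, x, F) ->
  exists2 p', (A `<=` cD p')%fset & good (p', x, F) /\ separated C (p', x, F).
Proof.
move=> [pq xY px] sep; have [p' p'p Ap'] := cond_dense_fsub p A.
exists p' => //; split; first split.
- exact: trans pq.
- exact: (fmem_mono trans p'p).
- exact: pointed_le px.
- by move=> p1 x1 F1 C1 s sp'; apply: (sep p1 x1 F1 C1); exact: trans p'p.
Qed.

Hypothesis hfc : countable_valued f.
Hypothesis hf : strong_property_Delta f.
Variable w1 : W.
Hypothesis w1P : is_omega1 w1.

(** A pair as in [compatible_pair] puts the point of the smaller index into the
    box of the larger. *)
Lemma no_separated_sequence (t : W -> triple) :
  ~ (forall al, below w1 al -> [/\ good (t al), al \in cD (t al).1.1,
       w1 \in cD (t al).1.1 & separated (t @` below al) (t al)]).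
Proof.
move=> H; pose p al := (t al).1.1; pose x al := (t al).1.2.
pose F al := (t al).2.
have tE al : t al = (p al, x al, F al) by rewrite /p /x /F; case: (t al) => [[]].
have px al : below w1 al -> pointed (p al) (x al) (F al).
  by move=> /H[]; rewrite tE => -[].
have [||||al [be [e [s [[Sal Sbe albe] sp sq xe sh]]]]] :=
    @compatible_pair _ _ f n hfc hf (below w1) p x _ w1.
- by case: w1P.
- by move=> al /H[].
- by move=> al /H[].
- by move=> al i u /px/(_ i)[xp _ _]; exact: xp.
have [_ _ _] := H be Sbe; rewrite (tE be) => /(_ (p al) (x al) (F al)).
apply; [by exists al|exact: sq|exact: sp|move=> i].
have [xbe /fsubsetP Fbe boxbe] := px be Sbe i.
have [xal _ _] := px al Sal i.
move: xbe boxbe; rewrite xe; case E: (x al i) xal => [u|//] /(_ u erefl) up.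
move=> /(_ (e u) erefl) ep /andP[_ /allP avoid].
rewrite /in_box /= sh // mem_ch_self //=; apply/allP => g gF.
by rewrite sh ?Fbe // avoid.
Qed.

Lemma exists_maximal_family :
  well_founded (fun u v : W => (u < v)%O) ->
  exists C : set triple, [/\ countable C, C `<=` good &
    forall t, good t -> ~ separated C t].
Proof.
move=> wf; apply: contrapT => /forallNP noC.
pose P (aC : W * set triple) (t : triple) := countable aC.2 -> aC.2 `<=` good ->
  [/\ good t, aC.1 \in cD t.1.1, w1 \in cD t.1.1 & separated aC.2 t].
have [Phi PhiP] : {Phi & forall aC, P aC (Phi aC)}.
  apply: choice => -[al C]; rewrite /P /=.
  have [[cC gC]|nC] := pselect (countable C /\ C `<=` good); last first.
    by exists (q0, fun _ => None, fun _ => fset0) => cC gC; case: nC.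
  have /existsNP[[[p x] F] /not_implyP[gt /contrapT sep]] :
      ~ forall t, good t -> ~ separated C t.
    by move=> H; apply: (noC C).
  (* w1 serves as the point common to all domains *)
  have [p' /fsubsetP Ap' [gp' sp']] := good_extend [fset al; w1]%fset gt sep.
  exists (p', x, F) => _ _; split=> //=; apply: Ap'.
    by rewrite !inE eqxx.
  by rewrite !inE eqxx orbT.
have [t tE] := wf_rec_set (fun al C => Phi (al, C)) wf.
apply: (@no_separated_sequence t) => al.
elim/(well_founded_ind wf): al => al IH alw.
have IH' be : below al be -> good (t be).
  move=> beal; have [] // := IH be beal; exact: lt_trans alw.
rewrite (tE al); apply: (PhiP (al, _)) => /=.
  by apply: countable_im; case: w1P => _; apply.
by move=> _ [be beal <-]; exact: IH'.
Qed.

End Powers.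

Theorem theorem3p2 (d : Order.disp_t) (W : orderType d) (hW : is_omega2 W)
    (f : {fset W} -> set W) (hfc : countable_valued f)
    (hf : strong_property_Delta f) :
  extension_satisfies
    (fall (fun n : nat =>
      hereditarily_separable (@cond_le d W f)
        (power_topology (@cond_le d W f) (K_space f) (n:=n)))).
Proof.
case: hW => wf [w1 [w1P _ _]] p n Y.
apply/fexE => q qp.
have [C [cC gC maxC]] := @exists_maximal_family d W f n Y q hfc hf w1 w1P wf.
exists (points_name C), q; first exact: cond_le_refl.
exact: (dense_points_name hf.1 cC gC maxC).
Qed.
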